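(* Let $(Q,d)$ be a fractional quiver of type $C$ and fix a labelling $g:Q_1\to\mathbb{Z}_{>0}$ of its arrows as in the context. Under the monomial transformation $q_1\mapsto q^2$, $q_2\mapsto t^{-2}$, $\mu_e\mapsto q^{d_{ij}}t^{-1}\mu_{ij}^{(g(e))}$ (where $i=\mathrm{t}(e)$ and $j=\mathrm{s}(e)$), the mass-deformed Cartan matrix $C^{\mathrm{KP}}$ corresponds to the matrix $C(q,t,\underline{\mu})q^{-D}t$ if and only if the following condition is satisfied: for any $i,j\in I$ with $i\sim j$, we have $f_{ij}=1$ or $f_{ji}=1$.
   Context: Let $I$ be a finite set and $C=(c_{ij})_{i,j\in I}$ an irreducible symmetrizable generalized Cartan matrix: $c_{ii}=2$; $c_{ij}\in\mathbb{Z}_{\le 0}$ for $i\ne j$; $c_{ij}=0$ iff $c_{ji}=0$; $DC$ is symmetric for some $D=\mathrm{diag}(d_i\mid i\in I)$, $d_i\in\mathbb{Z}_{>0}$; and, writing $i\sim j$ when $c_{ij}<0$, any two elements of $I$ are connected by a chain of $\sim$. For $i\sim j$ put $g_{ij}=\gcd(|c_{ij}|,|c_{ji}|)$, $f_{ij}=|c_{ij}|/g_{ij}$; $d_{ij}=\gcd(d_i,d_j)$. Then $f_{ij}=d_j/d_{ij}$. A fractional quiver $(Q,d)$ is a quiver $Q=(Q_0,Q_1,\mathrm{s},\mathrm{t})$ without loops ($\mathrm{s},\mathrm{t}$ = source, target) with a function $d:Q_0\to\mathbb{Z}_{>0}$, $d_i=d(i)$. It is of type $C$ if $Q_0=I$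 and $c_{ij}=2\delta_{i,j}-(d_j/d_{ij})\,|\{e\in Q_1\mid\{\mathrm{s}(e),\mathrm{t}(e)\}=\{i,j\}\}|$ for any $i,j\in I$. In this case $D=\mathrm{diag}(d_i\mid i\in I)$ is a symmetrizer of $C$ (the one used below), and $g_{ij}=|\{e\in Q_1\mid\{\mathrm{s}(e),\mathrm{t}(e)\}=\{i,j\}\}|$ when $i\sim j$. The labelling $g:Q_1\to\mathbb{Z}_{>0}$ is a function whose restriction is a bijection $\{e\in Q_1\mid\{\mathrm{s}(e),\mathrm{t}(e)\}=\{i,j\}\}\to\{1,\dots,g_{ij}\}$ for each $i\sim j$. The Kimura–Pestun mass-deformed Cartan matrix $C^{\mathrm{KP}}=(C^{\mathrm{KP}}_{ij})_{i,j\in I}$ has entries in $\mathbb{Z}[q_1^{\pm1},q_2^{\pm1},\mu_e^{\pm1}\mid e\in Q_1]$: $$C^{\mathrm{KP}}_{ij}=\delta_{i,j}(1+q_1^{-d_i}q_2^{-1})-\frac{1-q_1^{-d_j}}{1-q_1^{-d_{ij}}}\left(\sum_{e:i\to j}\mu_e^{-1}+\sum_{e:j\to i}\mu_eq_1^{-d_{ij}}q_2^{-1}\right).$$ $\Gamma$ is the multiplicative abelian group generated by $q,t$ and $\mu_{ij}^{(g)}$ ($i\sim j$, $1\le g\le g_{ij}$) with relations $\mu_{ij}^{(g)}\mu_{ji}^{(g)}=1$. With $[k]_q=(q^k-q^{-k})/(q-q^{-1})$, $C(q,t,\underline{\mu})$ is the $\mathbb{Z}[\Gamma]$-valued matrix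 with entries $C_{ii}=q^{d_i}t^{-1}+q^{-d_i}t$, $C_{ij}=-[f_{ij}]_{q^{d_i}}\sum_{g=1}^{g_{ij}}\mu_{ij}^{(g)}$ if $c_{ij}<0$, $C_{ij}=0$ otherwise; $q^{-D}=\mathrm{diag}(q^{-d_i}\mid i\in I)$. The monomial transformation is the ring homomorphism $\mathbb{Z}[q_1^{\pm1},q_2^{\pm1},\mu_e^{\pm1}\mid e\in Q_1]\to\mathbb{Z}[\Gamma]$ with the stated values, applied entrywise; ''corresponds'' means that the image of $C^{\mathrm{KP}}$ equals $C(q,t,\underline{\mu})q^{-D}t$. *)

(* Defs.v *)
From HB Require Import structures.
From mathcomp Require Import all_boot all_order all_algebra.
From mathcomp Require Import ring_quotient.
From mathcomp Require Import boolp classical_sets functions.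
From mathcomp Require Import finmap.
From mathcomp Require Import monalg.

Set Implicit Arguments.
Unset Strict Implicit.
Unset Printing Implicit Defensive.

Import GRing.Theory Num.Theory.

Local Open Scope ring_scope.

(* The group ring Z[V] of an abelian group V (written additively): finitely    *)
(* supported maps V -> int with the convolution product.  The ring structure   *)
(* that monalg puts on {malg int[K]} is not available here, because its        *)
(* monomial type K must not have nontrivial invertible elements.               *)

Section GroupRing.
Variable V : zmodType.

Definition groupRing : Type := {malg int[V]}.
HB.instance Definition _ := GRing.Zmodule.on groupRing.

Implicit Types x y z : groupRing.

Definition gexp (v : V) : groupRing := << v >>.

Definition gr_mul x y : groupRing :=
  \sum_(a <- msupp x) \sum_(b <- msupp y) << x@_a * y@_b *g a + b >>.

Lemma gr_mulEw (d1 d2 : {fset V}) x y :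
  (msupp x `<=` d1)%fset -> (msupp y `<=` d2)%fset ->
  gr_mul x y = \sum_(a <- d1) \sum_(b <- d2) << x@_a * y@_b *g a + b >>.
Proof.
move=> le1 le2; rewrite /gr_mul (big_fset_incl _ le1) /=.
  apply/eq_bigr=> a _; apply/big_fset_incl => // b _ /mcoeff_outdom ->.
  by rewrite mulr0 monalgU0.
move=> a _ /mcoeff_outdom xa.
by rewrite big1 // => b _; rewrite xa mul0r monalgU0.
Qed.

Lemma gr_mulC : commutative gr_mul.
Proof.
move=> x y; rewrite /gr_mul exchange_big /=.
by apply/eq_bigr=> a _; apply/eq_bigr=> b _; rewrite mulrC addrC.
Qed.

Lemma gr_mulUU c1 c2 (a b : V) :
  gr_mul << c1 *g a >> << c2 *g b >> = << c1 * c2 *g a + b >>.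
Proof. by rewrite (gr_mulEw msuppU_le msuppU_le) !big_seq_fset1 !mcoeffUU. Qed.

Lemma gr_mulDl : left_distributive gr_mul +%R.
Proof.
move=> x y z.
rewrite (gr_mulEw (msuppD_le x y) (fsubset_refl _)).
rewrite (gr_mulEw (fsubsetUl _ (msupp y)) (fsubset_refl (msupp z))).
rewrite (gr_mulEw (fsubsetUr (msupp x) _) (fsubset_refl (msupp z))).
rewrite -big_split /=; apply/eq_bigr=> a _.
rewrite -big_split /=; apply/eq_bigr=> b _.
by rewrite mcoeffD mulrDl monalgUD.
Qed.

Lemma gr_mul0 : left_zero 0 gr_mul.
Proof. by move=> x; rewrite /gr_mul msupp0 big_seq_fset0. Qed.

Lemma gr_mul_suml (I : Type) (r : seq I) (F : I -> groupRing) y :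
  gr_mul (\sum_(i <- r) F i) y = \sum_(i <- r) gr_mul (F i) y.
Proof.
exact: (big_morph (gr_mul^~ y) (fun _ _ => gr_mulDl _ _ _) (gr_mul0 y)).
Qed.

Lemma gr_mul_sumr (I : Type) (r : seq I) (F : I -> groupRing) y :
  gr_mul y (\sum_(i <- r) F i) = \sum_(i <- r) gr_mul y (F i).
Proof.
rewrite gr_mulC gr_mul_suml; apply: eq_bigr => i _; exact: gr_mulC.
Qed.

Lemma groupRingE x :
  x = \sum_(a <- msupp x) (<< x@_a *g a >> : groupRing).
Proof. exact: monalgE. Qed.

Lemma gr_mulA : associative gr_mul.
Proof.
move=> x y z.
rewrite (groupRingE x) 3!gr_mul_suml; apply: eq_bigr => a _.
rewrite (groupRingE y) gr_mul_suml 2!gr_mul_sumr gr_mul_suml; apply: eq_bigr => b _.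
rewrite (groupRingE z) 3!gr_mul_sumr; apply: eq_bigr => c _.
by rewrite !gr_mulUU mulrA addrA.
Qed.

Lemma gr_mul1 : left_id (gexp 0) gr_mul.
Proof.
move=> x; rewrite [in LHS](groupRingE x) gr_mul_sumr [RHS]groupRingE.
by apply: eq_bigr => a _; rewrite gr_mulUU mul1r add0r.
Qed.

Lemma gr_one_neq0 : gexp 0 != 0.
Proof. by rewrite /gexp monalgU_eq0 oner_eq0. Qed.

HB.instance Definition _ := GRing.Zmodule_isComNzRing.Build groupRing
  gr_mulA gr_mulC gr_mul1 gr_mulDl gr_one_neq0.

Definition gr_unit : pred groupRing := fun x => `[< exists y, y * x = 1 >].

Definition gr_inv x : groupRing :=
  if gr_unit x then xget x [set y | y * x = 1]%classic else x.

Lemma gr_mulVx : {in gr_unit, left_inverse 1 gr_inv *%R}.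
Proof.
move=> x ux; rewrite /gr_inv (_ : gr_unit x = true) //.
by have := asboolW ux; apply: xgetPex.
Qed.

Lemma gr_unitP x y : y * x = 1 -> gr_unit x.
Proof. by move=> yx; apply/asboolP; exists y. Qed.

Lemma gr_inv_out : {in [predC gr_unit], gr_inv =1 id}.
Proof.
by move=> x; rewrite inE /= /in_mem /= => /negPf ux; rewrite /gr_inv ux.
Qed.

HB.instance Definition _ := GRing.ComNzRing_hasMulInverse.Build groupRing
  gr_mulVx gr_unitP gr_inv_out.

Lemma groupRing_mulUU (c1 c2 : int) (a b : V) :
  (<< c1 *g a >> : groupRing) * << c2 *g b >> = << c1 * c2 *g a + b >>.
Proof. exact: gr_mulUU. Qed.

Lemma gexp0 : gexp 0 = 1. Proof. by []. Qed.

Lemma gexpD (a b : V) : gexp (a + b) = gexp a * gexp b.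
Proof. by rewrite groupRing_mulUU mulr1. Qed.

Lemma gexp_unit (a : V) : gexp a \is a GRing.unit.
Proof. by apply/unitrPr; exists (gexp (- a)); rewrite -gexpD subrr. Qed.

Lemma gexpN (a : V) : gexp (- a) = (gexp a)^-1.
Proof.
by apply: (mulrI (gexp_unit a)); rewrite -gexpD subrr mulrV ?gexp_unit.
Qed.

Lemma gexpMn (a : V) n : gexp (a *+ n) = gexp a ^+ n.
Proof. by elim: n => [|n IHn] //; rewrite mulrS exprS gexpD IHn. Qed.

Lemma mcoeff_gexpM (a b : V) x : (gexp a * x)@_b = x@_(b - a).
Proof.
rewrite [in LHS](groupRingE x) mulr_sumr raddf_sum /= [in RHS](groupRingE x) raddf_sum /=.
apply: eq_bigr => c _; rewrite groupRing_mulUU mul1r !mcoeffU.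
by rewrite [c == _]eq_sym subr_eq eq_sym addrC.
Qed.

(* 1 - e^a is not a zero divisor when a has infinite order. *)
Lemma gexp_lreg (a : V) : (forall n, a *+ n.+1 != 0) -> GRing.lreg (1 - gexp a).
Proof.
move=> aP x y exy; apply: subr0_eq; set z := x - y.
have ez : z = gexp a * z.
  apply: subr0_eq; rewrite -[X in X - _]mul1r -mulrBl /z mulrBr exy.
  exact: subrr.
have zE n b : z@_(b - a *+ n) = z@_b.
  elim: n b => [|n IHn] b; first by rewrite mulr0n subr0.
  by rewrite mulrS opprD addrA IHn [in RHS]ez mcoeff_gexpM.
apply: contrapT => z_neq0.
have [b zb] : exists b, z@_b != 0.
  apply: contrapT => zN; apply: z_neq0; apply/malgP => b.
  by rewrite mcoeff0; apply/eqP; apply: contrapT => /negP ?; apply: zN; exists b.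
pose s := [seq b - a *+ n | n <- iota 0 (size (msupp z)).+1].
have ltP m n : (m < n)%N -> b - a *+ m != b - a *+ n.
  move=> ltmn; apply/eqP => /addrI/oppr_inj/eqP.
  rewrite eq_sym -subr_eq0 -mulrnBr ?(ltnW ltmn) //.
  by rewrite -(ltn_predK (_ : 0 < n - m)%N) ?subn_gt0 // (negPf (aP _)).
have us : uniq s.
  rewrite map_inj_uniq ?iota_uniq // => m n emn; case: (ltngtP m n) => // /ltP.
    by rewrite emn eqxx.
  by rewrite emn eqxx.
have /(uniq_leq_size us) : {subset s <= msupp z}.
  by move=> _ /mapP[n _ ->]; rewrite -mcoeff_neq0 zE.
by rewrite size_map size_iota ltnn.
Qed.

(* The additive extension of a map V -> R to Z[V]. *)
Definition gr_lift (R : nzRingType) (f : V -> R) (x : groupRing) : R :=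
  mmap (intr : int -> R) f x.

Section Lift.
Variables (R : comNzRingType) (f : V -> R).

Lemma gr_liftU (c : int) (a : V) : gr_lift f << c *g a >> = c%:~R * f a.
Proof. exact: mmapU. Qed.

Lemma gr_liftX (a : V) : gr_lift f (gexp a) = f a.
Proof. by rewrite (gr_liftU 1) mul1r. Qed.

Lemma gr_lift_is_zmod_morphism : zmod_morphism (gr_lift f).
Proof. exact: mmap_is_additive. Qed.

Lemma gr_lift_is_monoid_morphism :
  f 0 = 1 -> {morph f : a b / a + b >-> a * b} -> monoid_morphism (gr_lift f).
Proof.
move=> f0 fD.
pose ev : {additive groupRing -> R} := HB.pack (gr_lift f)
  (GRing.isZmodMorphism.Build _ _ _ gr_lift_is_zmod_morphism).
have evE c a : ev << c *g a >> = c%:~R * f a by exact: gr_liftU.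
rewrite -[gr_lift f]/(ev : _ -> _); clearbody ev; split=> [|x y].
  by rewrite (evE 1 0) mul1r.
rewrite [in LHS](groupRingE x) [in RHS](groupRingE x) mulr_suml !raddf_sum mulr_suml.
apply: eq_bigr => a _.
rewrite [in LHS](groupRingE y) [in RHS](groupRingE y) mulr_sumr !raddf_sum mulr_sumr.
apply: eq_bigr => b _.
rewrite groupRing_mulUU !evE fD intrM; exact: mulrACA.
Qed.
End Lift.
End GroupRing.

(* The quotient a / b in a commutative ring, when b divides a and is not a zero *)
(* divisor; it is characterized by exact_divK and exact_div_eq.                 *)
Definition exact_div (R : comNzRingType) (a b : R) : R :=
  xget 0 [set x | x * b = a]%classic.

Lemma exact_divK (R : comNzRingType) (a b : R) :
  (exists x, x * b = a) -> exact_div a b * b = a.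
Proof. exact: (@xgetPex _ 0 [set x | x * b = a]%classic). Qed.

Lemma exact_div_eq (R : comNzRingType) (a b x : R) :
  GRing.lreg b -> x * b = a -> exact_div a b = x.
Proof.
move=> breg xb; apply: breg; rewrite ![b * _]mulrC exact_divK //.
by exists x.
Qed.

(* [k]_x = (x^k - x^-k) / (x - x^-1) *)
Definition qint (R : comUnitRingType) (x : R) (k : nat) : R :=
  exact_div (x ^+ k - x ^- k) (x - x^-1).

Lemma geometric_dvd (R : comNzRingType) (x : R) (m n : nat) :
  (m %| n)%N -> exists y, y * (1 - x ^+ m) = 1 - x ^+ n.
Proof.
case/dvdnP=> k ->; exists (\sum_(i < k) (x ^+ m) ^+ i).
by rewrite mulrC -opprB mulNr -subrX1 -exprM mulnC opprB.
Qed.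

Lemma qint_dvd (R : comUnitRingType) (x : R) (k : nat) :
  x \is a GRing.unit -> exists y, y * (x - x^-1) = x ^+ k - x ^- k.
Proof.
move=> ux; have [y yE] := geometric_dvd (x ^- 2) (dvd1n k).
exists (x ^+ k * x^-1 * y); rewrite expr1 in yE.
have -> : x - x^-1 = x * (1 - x ^- 2).
  by rewrite mulrBr mulr1 expr2 invrM // mulrA mulrV // mul1r.
rewrite mulrACA mulrVK // yE mulrBr mulr1; congr (_ - _).
by rewrite exprVn -exprM mulnC exprM expr2 invrM ?unitrX // mulrA mulrV ?unitrX // mul1r.
Qed.

(* Two distinguished variables and a family indexed by E. *)
Inductive vars (E : Type) : Type := var1 | var2 | var_mu of E.
Arguments var1 {E}.
Arguments var2 {E}.

Section VarsChoice.
Variable E : choiceType.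
Definition vars_code (x : vars E) : option (option E) :=
  match x with var1 => None | var2 => Some None | var_mu e => Some (Some e) end.
Definition vars_decode (x : option (option E)) : vars E :=
  match x with None => var1 | Some None => var2 | Some (Some e) => var_mu e end.
Lemma vars_codeK : cancel vars_code vars_decode. Proof. by case. Qed.
HB.instance Definition _ := Choice.copy (vars E) (can_type vars_codeK).
End VarsChoice.

(* The Laurent polynomial ring Z[x^{+-1} | x in X] is the group ring of the free *)
(* abelian group {malg int[X]} on X.                                             *)
Notation laurent X := (groupRing {malg int[X]}).

Section Laurent.
Variable X : choiceType.

Definition lvar (x : X) : laurent X := gexp << x >>.

(* The ring homomorphism sending each variable x to the unit h x. *)
Definition laurent_eval (R : comUnitRingType) (h : X -> R) (p : laurent X) : R :=
  gr_lift (fun m : {malg int[X]} => \prod_(x <- msupp m) h x ^ m@_x) p.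

Section EvalTheory.
Variables (R : comUnitRingType) (h : X -> R).
Hypothesis h_unit : forall x, h x \is a GRing.unit.

Let hm (m : {malg int[X]}) : R := \prod_(x <- msupp m) h x ^ m@_x.

Let hmEw (D : {fset X}) (m : {malg int[X]}) :
  (msupp m `<=` D)%fset -> hm m = \prod_(x <- D) h x ^ m@_x.
Proof.
move=> le; rewrite /hm [LHS](big_fset_incl _ le) => //= x xd /mcoeff_outdom ->.
by rewrite expr0z.
Qed.

Let hmD (a b : {malg int[X]}) : hm (a + b) = hm a * hm b.
Proof.
rewrite (hmEw (msuppD_le a b)) (hmEw (fsubsetUl _ (msupp b))).
rewrite (hmEw (fsubsetUr (msupp a) _)) -big_split /=.
by apply: eq_bigr => x _; rewrite mcoeffD exprzDr.
Qed.

Lemma laurent_evalX (x : X) : laurent_eval h (lvar x) = h x.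
Proof.
rewrite [LHS]gr_liftX msuppU oner_eq0 big_seq_fset1 mcoeffUU; exact: expr1z.
Qed.

Lemma laurent_eval_is_zmod_morphism : zmod_morphism (laurent_eval h).
Proof. exact: gr_lift_is_zmod_morphism. Qed.

Lemma laurent_eval_is_monoid_morphism : monoid_morphism (laurent_eval h).
Proof.
apply: gr_lift_is_monoid_morphism; last exact: hmD.
by rewrite msupp0 big_seq_fset0.
Qed.
End EvalTheory.

Lemma lvar_lreg (x : X) n : (0 < n)%N -> GRing.lreg (1 - lvar x ^- n).
Proof.
move=> n_gt0; rewrite -gexpMn -gexpN; apply: gexp_lreg => k.
apply/eqP => /(congr1 (mcoeff x))/eqP.
rewrite mcoeffMn mcoeffN mcoeffMn mcoeffUU mcoeff0 mulrn_eq0 oppr_eq0 mulrn_eq0 /=.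
by rewrite orbF eqn0Ngt n_gt0.
Qed.
End Laurent.

Definition subgroup_generated (V : zmodType) (A : set V) : set V :=
  smallest [set S : set V | S 0 /\ forall x y, S x -> S y -> S (x - y)]%classic A.

Section CartanMatrix.
Variables (I : finType) (C : I -> I -> int).

(* i ~ j, g_ij and f_ij *)
Definition adj : rel I := fun i j => C i j < 0.

Definition irreducible_symmetrizable_GCM : Prop :=
  [/\ forall i, C i i = 2,
      forall i j, i != j -> C i j <= 0,
      forall i j, C i j = 0 <-> C j i = 0,
      exists d : I -> nat, (forall i, (0 < d i)%N) /\
        (forall i j, (d i)%:Z * C i j = (d j)%:Z * C j i) &
      forall i j, connect adj i j].

Definition gmul (i j : I) : nat := gcdn `|C i j| `|C j i|.
Definition fmul (i j : I) : nat := `|C i j| %/ gmul i j.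

Definition mu_index : Type :=
  {x : I * I * nat | adj x.1.1 x.1.2 && (0 < x.2 <= gmul x.1.1 x.1.2)%N}.
HB.instance Definition _ := Choice.on mu_index.

End CartanMatrix.

Notation gamma_free C := {malg int[vars (mu_index C)]}.

Section Gamma.
Variables (I : finType) (C : I -> I -> int).

(* For a generalized Cartan matrix and a labelling, the default value 0 is *)
(* never used below: there i ~ j and 1 <= g <= g_ij.                       *)
Definition mu_free (i j : I) (g : nat) : gamma_free C :=
  if insub (i, j, g) is Some x then << var_mu x >> else 0.

Definition gamma_relators : set (gamma_free C) :=
  [set x | exists i j g, [/\ adj C i j, (0 < g <= gmul C i j)%N &
    x = mu_free i j g + mu_free j i g]]%classic.

Definition gamma_rel : {pred gamma_free C} :=
  fun x => `[< subgroup_generated gamma_relators x >].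

Lemma gamma_rel_zmod_closed : zmod_closed gamma_rel.
Proof.
split=> [|x y /asboolP xP /asboolP yP]; apply/asboolP.
  by move=> S [[]].
by move=> S SP; apply: SP.1.2; [apply: xP | apply: yP].
Qed.
HB.instance Definition _ :=
  GRing.isZmodClosed.Build (gamma_free C) gamma_rel gamma_rel_zmod_closed.
End Gamma.
Arguments gamma_relators {I} C.
Arguments gamma_rel {I} C.

(* The group Gamma, written additively: the free abelian group on the letters  *)
(* q = var1, t = var2 and mu_ij^(g), modulo the relations.                     *)
Notation gamma C := (Quotient.quot (gamma_rel C)).
Notation ZGamma C := (groupRing (gamma C)).

Section GammaElements.
Variables (I : finType) (C : I -> I -> int).

Definition gamma_elt (x : gamma_free C) : ZGamma C := gexp (\pi_(gamma C)%qT x).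

Definition Gq : ZGamma C := gamma_elt << var1 >>.
Definition Gt : ZGamma C := gamma_elt << var2 >>.
Definition Gmu (i j : I) (g : nat) : ZGamma C := gamma_elt (mu_free C i j g).

Lemma gamma_elt_unit x : gamma_elt x \is a GRing.unit.
Proof. exact: gexp_unit. Qed.

Let pi (x : gamma_free C) : gamma C := \pi_(gamma C)%qT x.

Let pi_eq0 (x : gamma_free C) : pi x = 0 -> x \in gamma_rel C.
Proof.
move=> x0; rewrite -[x]subr0 Quotient.idealrBE; apply/eqP.
rewrite /pi in x0; etransitivity; first exact: x0.
by symmetry; exact: (@pi_zeror _ _ _ _ _ (gamma C)).
Qed.

Let piB x y : pi (x - y) = pi x - pi y.
Proof. exact: (@pi_is_zmod_morphism _ _ _ (gamma C)). Qed.
Let pi0 : pi 0 = 0.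
Proof. by rewrite -(subrr 0) piB subrr. Qed.
Let piN x : pi (- x) = - pi x.
Proof. by rewrite -[in LHS](sub0r x) piB pi0 sub0r. Qed.
Let piMn x n : pi (x *+ n) = pi x *+ n.
Proof.
elim: n => [|n IHn]; first exact: pi0.
by rewrite !mulrS -IHn -{1}[x]opprK addrC piB piN opprK addrC.
Qed.

Let rel_var1 (x : gamma_free C) : x \in gamma_rel C -> x@_var1 = 0.
Proof.
move/asboolP/(_ [set x : gamma_free C | x@_var1 = 0]%classic); apply.
split; first by split=> [|y z /= y0 z0] /=; rewrite ?mcoeff0 ?mcoeffB ?y0 ?z0 ?subrr.
have mu0 i j g : (mu_free C i j g)@_var1 = 0.
  by rewrite /mu_free; case: insubP => [u _ _|_]; rewrite ?mcoeffU ?mcoeff0.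
by move=> _ [i [j [g [_ _ ->]]]] /=; rewrite mcoeffD !mu0 addr0.
Qed.

Lemma Gq_lreg n : (0 < n)%N -> GRing.lreg (1 - Gq ^- n).
Proof.
move=> n_gt0; rewrite -gexpMn -gexpN; apply: gexp_lreg => k.
rewrite -[X in X *+ n]/(pi << var1 >>) -piMn -piN -piMn; apply/eqP.
move=> /pi_eq0 /rel_var1 /eqP.
rewrite mcoeffMn mcoeffN mcoeffMn mcoeffUU mulrn_eq0 oppr_eq0 mulrn_eq0 /=.
by rewrite orbF eqn0Ngt n_gt0.
Qed.
End GammaElements.

(* Finiteness of the set of arrows is forced by the counting formula in *)
(* quiver_of_type, as I is finite and there are no loops.               *)
Record fractional_quiver (I : finType) := FractionalQuiver {
  arrow : finType;
  src : arrow -> I;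
  tgt : arrow -> I;
  no_loop : forall e, src e != tgt e;
  fqd : I -> nat;
  fqd_gt0 : forall i, (0 < fqd i)%N
}.

Section Quiver.
Variables (I : finType) (Q : fractional_quiver I).
Implicit Types (i j : I) (e : arrow Q).

Definition dgcd i j : nat := gcdn (fqd Q i) (fqd Q j).

Definition edges i j : {set arrow Q} :=
  [set e | [set src e; tgt e]%SET == [set i; j]%SET]%SET.

Definition quiver_of_type (C : I -> I -> int) : Prop :=
  forall i j, C i j =
    2 * (i == j)%:Z - (fqd Q j %/ dgcd i j)%N%:Z * #|edges i j|%:Z.

Definition is_labelling (C : I -> I -> int) (g : arrow Q -> nat) : Prop :=
  forall i j, adj C i j ->
    set_bij [set e | e \in edges i j]%classic
            [set k | (1 <= k <= gmul C i j)%N]%classic g.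

Local Notation KPring := (laurent (vars (arrow Q))).

Definition q1 : KPring := lvar var1.
Definition q2 : KPring := lvar var2.
Definition mu e : KPring := lvar (var_mu e).

(* Arrows e : i -> j have source i and target j. *)
Definition CKP i j : KPring :=
  (1 + q1 ^- fqd Q i * q2^-1) *+ (i == j)
  - exact_div (1 - q1 ^- fqd Q j) (1 - q1 ^- dgcd i j)
    * (\sum_(e | (src e == i) && (tgt e == j)) (mu e)^-1
       + \sum_(e | (src e == j) && (tgt e == i)) mu e * q1 ^- dgcd i j * q2^-1).

Definition monomial_value (C : I -> I -> int) (g : arrow Q -> nat)
    (x : vars (arrow Q)) : ZGamma C :=
  match x with
  | var1 => Gq C ^+ 2
  | var2 => Gt C ^- 2
  | var_mu e => Gq C ^+ dgcd (tgt e) (src e) * (Gt C)^-1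
                * Gmu C (tgt e) (src e) (g e)
  end.

Definition monomial_transformation (C : I -> I -> int) (g : arrow Q -> nat) :
  KPring -> ZGamma C := laurent_eval (monomial_value C g).

Section MonomialTransformation.
Variables (C : I -> I -> int) (g : arrow Q -> nat).

Lemma monomial_value_unit x : monomial_value C g x \is a GRing.unit.
Proof.
have u (y : gamma_free C) : gamma_elt y \is a GRing.unit := gamma_elt_unit y.
case: x => [||e].
- exact/unitrX/u.
- by rewrite [monomial_value _ _ _]/= unitrV; exact/unitrX/u.
- rewrite [monomial_value _ _ _]/= unitrMr; first exact: u.
  rewrite unitrMr; last exact/unitrX/u.
  by rewrite unitrV; exact: u.
Qed.

Lemma monomial_transformation_is_zmod_morphism :
  zmod_morphism (monomial_transformation C g).
Proof. exact: laurent_eval_is_zmod_morphism. Qed.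

Lemma monomial_transformation_is_monoid_morphism :
  monoid_morphism (monomial_transformation C g).
Proof. exact: laurent_eval_is_monoid_morphism monomial_value_unit. Qed.

Lemma monomial_transformationX x :
  monomial_transformation C g (lvar x) = monomial_value C g x.
Proof. exact: laurent_evalX. Qed.
End MonomialTransformation.

Definition Cqtmu (C : I -> I -> int) i j : ZGamma C :=
  if i == j then
    Gq C ^+ fqd Q i * (Gt C)^-1 + Gq C ^- fqd Q i * Gt C
  else if C i j < 0 then
    - qint (Gq C ^+ fqd Q i) (fmul C i j)
      * \sum_(1 <= g < (gmul C i j).+1) Gmu C i j g
  else 0.

Definition q_minus_D (C : I -> I -> int) i j : ZGamma C :=
  Gq C ^- fqd Q i *+ (i == j).

(* The divisions in CKP and Cqtmu are exact, by elements that are not zero divisors. *)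
Lemma dgcd_gt0 i j : (0 < dgcd i j)%N.
Proof. by rewrite gcdn_gt0 fqd_gt0. Qed.

Lemma CKP_divK i j :
  exact_div (1 - q1 ^- fqd Q j) (1 - q1 ^- dgcd i j) * (1 - q1 ^- dgcd i j)
  = 1 - q1 ^- fqd Q j.
Proof.
by apply: exact_divK; rewrite -!exprVn; apply/geometric_dvd/dvdn_gcdr.
Qed.

Lemma CKP_lreg i j : GRing.lreg (1 - q1 ^- dgcd i j).
Proof. exact/lvar_lreg/dgcd_gt0. Qed.

Lemma qint_GqK (C : I -> I -> int) (d k : nat) :
  qint (Gq C ^+ d) k * (Gq C ^+ d - Gq C ^- d) = Gq C ^+ d ^+ k - Gq C ^+ d ^- k.
Proof. by apply/exact_divK/qint_dvd; rewrite unitrX ?gamma_elt_unit. Qed.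

Lemma qint_Gq_lreg (C : I -> I -> int) (d : nat) :
  (0 < d)%N -> GRing.lreg (Gq C ^+ d - Gq C ^- d).
Proof.
move=> d_gt0; have uq : Gq C ^+ d \is a GRing.unit.
  by rewrite unitrX ?gamma_elt_unit.
have -> : Gq C ^+ d - Gq C ^- d = Gq C ^+ d * (1 - Gq C ^- (d + d)).
  by rewrite mulrBr mulr1 exprD invrM // mulrA mulrV // mul1r.
by apply: lregM; [exact: mulrI | apply: Gq_lreg; rewrite addn_gt0 d_gt0].
Qed.
End Quiver.

Definition mulmat (R : pzRingType) (I : finType) (A B : I -> I -> R) : I -> I -> R :=
  fun i j => \sum_k A i k * B k j.

(* Main.v *)
(* The diagonal entries always agree, and so do the entries with i <> j not
   adjacent. For i ~ j both sides are multiples of the nonzero sum S of the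
   mu_ij^(g) by a common unit; they agree if and only if
   [f_ij]_x S = [f_ij]_y S with x = q^d_ij and y = q^d_i. As d_i = f_ji d_ij,
   this holds when f_ij = 1 or f_ji = 1. Conversely, specializing q = 2 and
   t = mu = 1 turns it into an equality of rational numbers, whose 2-adic
   valuations force f_ij = 1 or d_i = d_ij, that is, f_ji = 1. *)

Require Import Defs.
From HB Require Import structures.
From mathcomp Require Import boolp classical_sets functions.
From mathcomp Require Import all_boot all_order all_algebra ring_quotient ring.
From mathcomp Require Import finmap monalg.

Set Implicit Arguments.
Unset Strict Implicit.
Unset Printing Implicit Defensive.

Import GRing.Theory Num.Theory.
Local Open Scope ring_scope.

Lemma qint1 (R : comUnitRingType) (x : R) :
  GRing.lreg (x - x^-1) -> qint x 1 = 1.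
Proof. by move=> xP; apply: exact_div_eq; rewrite ?mul1r ?expr1. Qed.

Lemma rmorph_qint (R S : comUnitRingType) (f : {rmorphism R -> S}) (x : R) (k : nat) :
  x \is a GRing.unit ->
  f (qint x k) * (f x - (f x)^-1) = f x ^+ k - f x ^- k.
Proof.
move=> ux; have uxk : x ^+ k \is a GRing.unit by rewrite unitrX.
rewrite -(rmorphXn f) -(rmorphV _ ux) -(rmorphV _ uxk) -!rmorphB -rmorphM.
by congr (f _); apply/exact_divK/qint_dvd.
Qed.

Lemma rmorph_mulIf (R : nzRingType) (S : idomainType) (f : {rmorphism R -> S})
    (x y s : R) :
  f s != 0 -> x * s = y * s -> f x = f y.
Proof. by move=> fs0 /(congr1 f); rewrite !rmorphM => /(mulIf fs0). Qed.

Lemma factor_qint (R : comNzRingType) (y w c z t s : R) :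
  y * w = c * z -> y * (w * t * s) = c * s * z * t.
Proof. by move=> yw; rewrite -mulrA mulrA yw; ring. Qed.

Lemma oppr_mul_unit_inj (R : comUnitRingType) (a b z t : R) :
  z \is a GRing.unit -> t \is a GRing.unit ->
  - a * z * t = - b * z * t <-> a = b.
Proof. by move=> uz ut; split=> [/(mulIr ut)/(mulIr uz)/oppr_inj|->]. Qed.

Lemma geometric_qint (R : comUnitRingType) (x y : R) (a b f : nat) :
  x \is a GRing.unit -> GRing.lreg (x ^+ a - x ^- a) -> b = (a * f)%N ->
  y * (1 - (x ^+ 2) ^- a) = 1 - (x ^+ 2) ^- b ->
  y * x ^- a = qint (x ^+ a) f * x ^- b.
Proof.
move=> ux xP def_b yE.
have uX n : x ^+ n \is a GRing.unit by rewrite unitrX.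
have sqrV n : (x ^+ n - x ^- n) * x ^- n = 1 - (x ^+ 2) ^- n.
  rewrite mulrBl mulrV ?uX // -[in RHS]exprM mulnC exprM.
  by rewrite [in RHS]expr2 invrM ?uX.
have QE : qint (x ^+ a) f * (x ^+ a - x ^- a) = x ^+ b - x ^- b.
  by rewrite def_b [in RHS]exprM; apply/exact_divK/qint_dvd.
apply: xP; rewrite [LHS]mulrCA sqrV yE mulrA [_ * qint _ _]mulrC QE.
by rewrite sqrV.
Qed.

Lemma diag_weight (R : comUnitRingType) (x t : R) (d : nat) :
  x \is a GRing.unit -> t \is a GRing.unit ->
  (x ^+ d * t^-1 + x ^- d * t) * x ^- d * t = 1 + (x ^+ 2) ^- d * t ^+ 2.
Proof.
move=> ux ut; rewrite -exprM mulnC exprM; set y := x ^+ d.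
have uy : y \is a GRing.unit by rewrite unitrX.
rewrite (expr2 y) (expr2 t) invrM // -mulrA mulrDl.
by rewrite [y / t * _]mulrACA mulrV // mulVr // mul1r [y^-1 * t * _]mulrACA.
Qed.

Lemma direct_arrow_weight (R : comUnitRingType) (x t m : R) :
  x \is a GRing.unit -> t \is a GRing.unit -> m \is a GRing.unit ->
  (x * t^-1 * m)^-1 = x^-1 * t * m^-1.
Proof.
move=> ux ut um; rewrite invrM ?unitrM ?unitrV ?ux // invrM ?unitrV //.
by rewrite invrK mulrC [t * _]mulrC.
Qed.

Lemma reversed_arrow_weight (R : comUnitRingType) (x t m : R) (d : nat) :
  x \is a GRing.unit -> t \is a GRing.unit ->
  x ^+ d * t^-1 * m * (x ^+ 2) ^- d * t ^+ 2 = x ^- d * t * m.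
Proof.
move=> ux ut; rewrite -exprM mulnC exprM; set y := x ^+ d.
have uy : y \is a GRing.unit by rewrite unitrX.
rewrite (expr2 y) (expr2 t) invrM // -[LHS]mulrA [LHS]mulrAC.
congr (_ * m); rewrite [y^-1 * _ * _]mulrACA mulrA [y / t * _]mulrACA.
by rewrite mulrV // mulVr // !mul1r.
Qed.

(* With x = 2^a and y = 2^b, equating [f]_x and [f]_y and clearing denominators
   gives y^(f-1) (y^2 - 1) (x^(2f) - 1) = x^(f-1) (x^2 - 1) (y^(2f) - 1), whose
   two sides have 2-adic valuations b (f - 1) and a (f - 1). *)
Lemma pow2_qint_inj (P P' : rat) (a b f : nat) :
  (0 < a)%N -> (0 < b)%N -> (1 < f)%N ->
  P * (2 ^+ a - 2 ^- a) = 2 ^+ a ^+ f - 2 ^+ a ^- f ->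
  P' * (2 ^+ b - 2 ^- b) = 2 ^+ b ^+ f - 2 ^+ b ^- f ->
  P = P' -> a = b.
Proof.
move=> a_gt0 b_gt0 f_gt1 Pa + P_eq; rewrite -P_eq => Pb.
have clear_den c : P * (2 ^+ c - 2 ^- c) = 2 ^+ c ^+ f - 2 ^+ c ^- f ->
    P * (2 ^ (c * f.-1))%:R * (2 ^ (c * 2) - 1)%:R = (2 ^ (c * (f * 2)) - 1)%:R.
  rewrite !natrB ?expn_gt0 // !natrX !exprM -[f in X in X -> _](ltn_predK f_gt1).
  rewrite -[f in X in _ -> _ = X](ltn_predK f_gt1) exprSr.
  set x := 2 ^+ c; set w := x ^+ f.-1 => PE.
  have x0 : x != 0 by rewrite expf_neq0.
  have w0 : w != 0 by rewrite expf_neq0.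
  transitivity (P * (x - x^-1) * (w * x)); first by field.
  by rewrite PE; field; rewrite x0 w0.
have odd_pow2B1 n : (0 < n)%N -> odd (2 ^ n - 1).
  by move=> n0; rewrite oddB ?expn_gt0 // oddX eqn0Ngt n0.
have valuation u v m n : odd u -> odd v -> (u * 2 ^ m = v * 2 ^ n)%N -> m = n.
  have log_odd w : odd w -> logn 2 w = 0%N.
    by move=> wP; apply: logn_coprime; rewrite coprime2n.
  move=> uP vP /(congr1 (logn 2)); rewrite !lognM ?(odd_gt0 uP) ?(odd_gt0 vP) ?expn_gt0 //.
  by rewrite (log_odd u) // (log_odd v) // !pfactorK.
have f1_gt0 : (0 < f.-1)%N by case: f f_gt1 {Pa Pb clear_den} => [|[]].
suff /eqP : (a * f.-1 = b * f.-1)%N by rewrite eqn_pmul2r // => /eqP.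
apply: (valuation ((2 ^ (a * 2) - 1) * (2 ^ (b * (f * 2)) - 1))%N
                  ((2 ^ (b * 2) - 1) * (2 ^ (a * (f * 2)) - 1))%N).
- by rewrite oddM !odd_pow2B1 // !muln_gt0 ?a_gt0 ?b_gt0 ?(ltnW f_gt1).
- by rewrite oddM !odd_pow2B1 // !muln_gt0 ?a_gt0 ?b_gt0 ?(ltnW f_gt1).
apply/eqP; rewrite -(eqr_nat rat) !natrM -(clear_den _ Pa) -(clear_den _ Pb).
by apply/eqP; ring.
Qed.

Section FractionalQuiver.
Variables (I : finType) (C : I -> I -> int) (Q : fractional_quiver I).
Hypothesis Q_type : quiver_of_type Q C.

Lemma dgcdC i j : dgcd Q i j = dgcd Q j i.
Proof. exact: gcdnC. Qed.

Lemma edgesC i j : edges Q i j = edges Q j i.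
Proof. by apply/setP => e; rewrite !inE [[set i; j]]setUC. Qed.

Lemma edges_diag i : edges Q i i = set0.
Proof.
apply/setP => e; rewrite !inE setUid; apply/negbTE/eqP => eE.
have := no_loop e.
have /set1P-> : src e \in [set i] by rewrite -eE set21.
have /set1P-> : tgt e \in [set i] by rewrite -eE set22.
by rewrite eqxx.
Qed.

Lemma mem_edges i j e : i != j ->
  (e \in edges Q i j) =
  ((src e == i) && (tgt e == j)) || ((src e == j) && (tgt e == i)).
Proof.
move=> nij; rewrite inE; apply/eqP/orP.
  move=> eE; have := no_loop e.
  have /set2P[->|->] : src e \in [set i; j] by rewrite -eE set21.
    have /set2P[->|->] : tgt e \in [set i; j] by rewrite -eE set22.
      by rewrite eqxx.
    by left; rewrite !eqxx.
  have /set2P[->|->] : tgt e \in [set i; j] by rewrite -eE set22.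
    by right; rewrite !eqxx.
  by rewrite eqxx.
by case=> /andP[/eqP-> /eqP->] //; rewrite setUC.
Qed.

Lemma fqd_dgcd i j : fqd Q j = (dgcd Q i j * (fqd Q j %/ dgcd Q i j))%N.
Proof. by rewrite mulnC divnK ?dvdn_gcdr. Qed.

Lemma absz_offdiag i j : i != j ->
  `|C i j|%N = (fqd Q j %/ dgcd Q i j * #|edges Q i j|)%N.
Proof.
by move=> /negbTE nij; rewrite Q_type nij mulr0 sub0r abszN abszM.
Qed.

Lemma adj_neq i j : adj C i j -> i != j.
Proof.
by apply: contraTneq => ->; rewrite /adj Q_type edges_diag cards0 eqxx mulr0 subr0.
Qed.

Lemma adj_edges i j : adj C i j = (edges Q i j != set0).
Proof.
have [->|nij] := eqVneq i j.
  by rewrite edges_diag eqxx /adj Q_type edges_diag cards0 eqxx mulr0 subr0.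
rewrite /adj Q_type (negbTE nij) mulr0 sub0r oppr_lt0 -PoszM ltz_nat.
by rewrite muln_gt0 divn_gt0 ?dgcd_gt0 // dvdn_leq ?dvdn_gcdr ?fqd_gt0 //= card_gt0.
Qed.

Lemma adjC i j : adj C i j = adj C j i.
Proof. by rewrite !adj_edges edgesC. Qed.

Lemma gmul_edges i j : adj C i j -> gmul C i j = #|edges Q i j|.
Proof.
move=> aij; have nij := adj_neq aij; have nji : j != i by rewrite eq_sym.
rewrite /gmul !absz_offdiag // (edgesC j) (dgcdC j) -muln_gcdl.
suff -> : gcdn (fqd Q j %/ dgcd Q i j) (fqd Q i %/ dgcd Q i j) = 1%N.
  by rewrite mul1n.
apply/eqP; rewrite -(eqn_pmul2r (dgcd_gt0 Q i j)) mul1n muln_gcdl.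
by rewrite !divnK ?dvdn_gcdr ?dvdn_gcdl // gcdnC.
Qed.

Lemma fmul_fqd i j : adj C i j -> fmul C i j = (fqd Q j %/ dgcd Q i j)%N.
Proof.
move=> aij; rewrite /fmul gmul_edges // absz_offdiag ?adj_neq // mulnK //.
by rewrite card_gt0 -adj_edges.
Qed.

End FractionalQuiver.

Section GammaTheory.
Variables (I : finType) (C : I -> I -> int).

Lemma pi_gammaB (x y : gamma_free C) :
  \pi_(gamma C)%qT (x - y) = \pi_(gamma C)%qT x - \pi_(gamma C)%qT y.
Proof. exact: (@pi_is_zmod_morphism _ _ _ (gamma C)). Qed.

Lemma pi_gamma0 : \pi_(gamma C)%qT 0 = 0.
Proof. by rewrite -(subrr 0) pi_gammaB subrr. Qed.

Lemma pi_gammaD (x y : gamma_free C) :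
  \pi_(gamma C)%qT (x + y) = \pi_(gamma C)%qT x + \pi_(gamma C)%qT y.
Proof.
by rewrite -{1}[y]opprK pi_gammaB -[in LHS](sub0r y) pi_gammaB pi_gamma0 sub0r opprK.
Qed.

Lemma pi_gamma_eq (x y : gamma_free C) :
  \pi_(gamma C)%qT x = \pi_(gamma C)%qT y <-> subgroup_generated (gamma_relators C) (x - y).
Proof.
split=> [/eqP|xy]; last apply/eqP.
  by rewrite -Quotient.idealrBE => /asboolP.
by rewrite -Quotient.idealrBE; apply/asboolP.
Qed.

Lemma GmuV i j g : adj C i j -> (0 < g <= gmul C i j)%N ->
  (Gmu C j i g)^-1 = Gmu C i j g.
Proof.
move=> aij gP; apply: (mulrI (gamma_elt_unit (mu_free C j i g))).
rewrite mulrV ?gamma_elt_unit // -[RHS]gexpD -pi_gammaD -[LHS]/(gexp 0).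
congr gexp; rewrite -pi_gamma0; apply/pi_gamma_eq.
rewrite sub0r => S [[S0 SB] SA]; rewrite -[- _]sub0r; apply: SB => //.
by apply: SA; exists i, j, g; split=> //; rewrite addrC.
Qed.

Definition q_degree (v : gamma C) : int := (repr v)@_var1.

Lemma rel_q_degree (x : gamma_free C) :
  subgroup_generated (gamma_relators C) x -> x@_var1 = 0.
Proof.
move/(_ [set x : gamma_free C | x@_var1 = 0]%classic); apply.
split; first by split=> [|y z /= y0 z0] /=; rewrite ?mcoeff0 ?mcoeffB ?y0 ?z0 ?subrr.
have mu0 i j g : (mu_free C i j g)@_var1 = 0.
  by rewrite /mu_free; case: insubP => [u _ _|_]; rewrite ?mcoeffU ?mcoeff0.
by move=> _ [i [j [g [_ _ ->]]]] /=; rewrite mcoeffD !mu0 addr0.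
Qed.

Lemma q_degree_pi (x : gamma_free C) : q_degree (\pi_(gamma C)%qT x) = x@_var1.
Proof.
apply/eqP; rewrite -subr_eq0 -mcoeffB; apply/eqP/rel_q_degree/pi_gamma_eq.
by rewrite reprK.
Qed.

(* The specialization q = 2, t = 1, mu = 1. *)
Definition gamma_eval2 : ZGamma C -> rat := gr_lift (fun v => 2 ^ q_degree v).

Fact gamma_eval2_is_zmod_morphism : zmod_morphism gamma_eval2.
Proof. exact: gr_lift_is_zmod_morphism. Qed.

Fact gamma_eval2_is_monoid_morphism : monoid_morphism gamma_eval2.
Proof.
apply: gr_lift_is_monoid_morphism => [|u v].
  by rewrite -pi_gamma0 q_degree_pi mcoeff0.
by rewrite -[u]reprK -[v]reprK -pi_gammaD !q_degree_pi mcoeffD exprzDr.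
Qed.

HB.instance Definition _ := GRing.isZmodMorphism.Build (ZGamma C) rat gamma_eval2
  gamma_eval2_is_zmod_morphism.
HB.instance Definition _ := GRing.isMonoidMorphism.Build (ZGamma C) rat gamma_eval2
  gamma_eval2_is_monoid_morphism.

Lemma gamma_eval2_q : gamma_eval2 (Gq C) = 2.
Proof. by rewrite [LHS]gr_liftX q_degree_pi mcoeffUU. Qed.

Lemma gamma_eval2_mu i j g : gamma_eval2 (Gmu C i j g) = 1.
Proof.
rewrite [LHS]gr_liftX q_degree_pi /mu_free.
by case: insubP => [u _ _|_]; rewrite ?mcoeffU ?mcoeff0.
Qed.

Lemma gamma_eval2_qint d f :
  gamma_eval2 (qint (Gq C ^+ d) f) * (2 ^+ d - 2 ^- d) = 2 ^+ d ^+ f - 2 ^+ d ^- f.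
Proof.
have uX : Gq C ^+ d \is a GRing.unit by rewrite unitrX ?gamma_elt_unit.
have evq : gamma_eval2 (Gq C ^+ d) = 2 ^+ d.
  by rewrite rmorphXn; congr (_ ^+ d); exact: gamma_eval2_q.
rewrite -evq; exact: rmorph_qint uX.
Qed.

End GammaTheory.

Section MonomialImage.
Variables (I : finType) (C : I -> I -> int) (Q : fractional_quiver I).
Variable g : arrow Q -> nat.

HB.instance Definition _ := GRing.isZmodMorphism.Build (laurent (vars (arrow Q)))
  (ZGamma C) (monomial_transformation C g)
  (monomial_transformation_is_zmod_morphism C g).
HB.instance Definition _ := GRing.isMonoidMorphism.Build (laurent (vars (arrow Q)))
  (ZGamma C) (monomial_transformation C g)
  (monomial_transformation_is_monoid_morphism C g).

Hypothesis Q_type : quiver_of_type Q C.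
Hypothesis g_labelling : is_labelling C g.

Local Notation phi := (monomial_transformation C g
  : {rmorphism laurent (vars (arrow Q)) -> ZGamma C}).
Local Notation q := (Gq C).
Local Notation t := (Gt C).

Lemma Gq_unit : q \is a GRing.unit. Proof. exact: gamma_elt_unit. Qed.
Lemma Gt_unit : t \is a GRing.unit. Proof. exact: gamma_elt_unit. Qed.

Lemma labelling_range i j e : adj C i j -> e \in edges Q i j ->
  (0 < g e <= gmul C i j)%N.
Proof. by move=> aij ein; case: (g_labelling aij) => gP _ _; apply: gP. Qed.

Lemma sum_labelling (R : nmodType) (F : nat -> R) i j : adj C i j ->
  \sum_(e in edges Q i j) F (g e) = \sum_(1 <= k < (gmul C i j).+1) F k.
Proof.
move=> aij; case: (g_labelling aij) => gP g_inj g_surj.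
rewrite -big_enum /= -(big_map g predT F); apply: perm_big.
apply: uniq_perm; rewrite ?iota_uniq //.
  rewrite map_inj_in_uniq ?enum_uniq // => e e'; rewrite !mem_enum => ein ein'.
  by apply: g_inj; apply: mem_set.
move=> k; rewrite mem_index_iota; apply/mapP/idP => [[e]|kP].
  by rewrite mem_enum => ein ->; apply: gP.
by have [e ein ge] := g_surj k kP; exists e; rewrite ?mem_enum.
Qed.

Lemma phi_lvar x : phi (lvar x) = monomial_value C g x.
Proof. exact: monomial_transformationX. Qed.

Lemma phi_q1X n : phi (q1 Q ^- n) = (q ^+ 2) ^- n.
Proof.
have u1 : q1 Q \is a GRing.unit by exact: gexp_unit.
have uX : q1 Q ^+ n \is a GRing.unit by rewrite unitrX.
by rewrite (rmorphV _ uX) rmorphXn phi_lvar.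
Qed.

Lemma phi_q2V : phi (q2 Q)^-1 = t ^+ 2.
Proof.
have u2 : q2 Q \is a GRing.unit by exact: gexp_unit.
by rewrite (rmorphV _ u2) phi_lvar invrK.
Qed.

Lemma phi_arrow_sum i j : adj C i j ->
  phi (\sum_(e | (src e == i) && (tgt e == j)) (mu e)^-1
       + \sum_(e | (src e == j) && (tgt e == i))
           mu e * q1 Q ^- dgcd Q i j * (q2 Q)^-1)
  = q ^- dgcd Q i j * t * \sum_(1 <= k < (gmul C i j).+1) Gmu C i j k.
Proof.
move=> aij; have nij := adj_neq Q_type aij; have edgeE := mem_edges _ nij.
have uqX n : q ^+ n \is a GRing.unit by rewrite unitrX ?Gq_unit.
rewrite -sum_labelling // mulr_sumr.
under [RHS]eq_bigl => e do rewrite edgeE.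
rewrite bigU /=; last first.
  rewrite disjoint_subset; apply/subsetP => e; rewrite !unfold_in /=.
  by case/andP=> /eqP-> _; rewrite (negbTE nij).
rewrite rmorphD !rmorph_sum; congr (_ + _); apply: eq_bigr => e eP.
  have /(labelling_range aij) gP : e \in edges Q i j by rewrite edgeE eP.
  case/andP: eP => /eqP si /eqP tj.
  have umu : mu e \is a GRing.unit by exact: gexp_unit.
  rewrite (rmorphV _ umu) phi_lvar /monomial_value si tj.
  rewrite (direct_arrow_weight (uqX _) Gt_unit (gamma_elt_unit _)).
  by rewrite (GmuV aij gP) dgcdC.
case/andP: eP => /eqP sj /eqP ti.
rewrite 2!rmorphM phi_q1X phi_q2V phi_lvar /monomial_value sj ti.
exact: reversed_arrow_weight Gq_unit Gt_unit.
Qed.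

Lemma phi_CKP_diag i : phi (CKP Q i i) = 1 + (q ^+ 2) ^- fqd Q i * t ^+ 2.
Proof.
have -> : CKP Q i i = 1 + q1 Q ^- fqd Q i * (q2 Q)^-1.
  rewrite /CKP eqxx mulr1n !big_pred0 ?addr0 ?mulr0 ?subr0 // => e;
    by apply: contraNF (no_loop e) => /andP[/eqP-> /eqP->].
by rewrite rmorphD rmorph1 rmorphM phi_q1X phi_q2V.
Qed.

Lemma CKP_nadj i j : i != j -> ~~ adj C i j -> CKP Q i j = 0.
Proof.
move=> nij; rewrite (adj_edges Q_type) negbK => /eqP e0.
rewrite /CKP (negbTE nij) mulr0n !big_pred0 ?addr0 ?mulr0 ?subr0 // => e.
all: have := mem_edges e nij; rewrite e0 inE.
all: by move/esym/negbT/norP => [/negbTE eij /negbTE eji]; rewrite ?eij ?eji.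
Qed.

Lemma phi_CKP_adj i j : adj C i j ->
  phi (CKP Q i j) =
  - (qint (q ^+ dgcd Q i j) (fmul C i j)
     * \sum_(1 <= k < (gmul C i j).+1) Gmu C i j k) * q ^- fqd Q j * t.
Proof.
move=> aij; rewrite /CKP (negbTE (adj_neq Q_type aij)) mulr0n sub0r.
rewrite rmorphN rmorphM (phi_arrow_sum aij) 2!mulNr.
apply: (congr1 -%R); apply: factor_qint.
set y := phi _.
have yE : y * (1 - (q ^+ 2) ^- dgcd Q i j) = 1 - (q ^+ 2) ^- fqd Q j.
  have := congr1 phi (CKP_divK Q i j).
  by rewrite rmorphM !rmorphB rmorph1 !phi_q1X.
have := geometric_qint Gq_unit (qint_Gq_lreg (dgcd_gt0 Q i j))
          (fqd_dgcd Q i j) yE.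
by rewrite -(fmul_fqd Q_type aij).
Qed.

Lemma mul_q_minus_D (A : I -> I -> ZGamma C) i j :
  mulmat A (q_minus_D Q C) i j = A i j * q ^- fqd Q j.
Proof.
rewrite /mulmat (bigD1 j) //= big1 ?addr0 => [|k /negbTE nkj].
  by rewrite /q_minus_D eqxx.
by rewrite /q_minus_D nkj mulr0.
Qed.

Lemma phi_CKP_adj_eq i j : adj C i j ->
  phi (CKP Q i j) = mulmat (Cqtmu Q C) (q_minus_D Q C) i j * t <->
  qint (q ^+ dgcd Q i j) (fmul C i j)
    * \sum_(1 <= k < (gmul C i j).+1) Gmu C i j k =
  qint (q ^+ fqd Q i) (fmul C i j)
    * \sum_(1 <= k < (gmul C i j).+1) Gmu C i j k.
Proof.
move=> aij; rewrite (phi_CKP_adj aij) mul_q_minus_D /Cqtmu.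
have cij_lt0 : C i j < 0 by exact: aij.
rewrite (negbTE (adj_neq Q_type aij)) cij_lt0 (mulNr (qint _ _)).
by apply: oppr_mul_unit_inj; rewrite ?Gt_unit // unitrV unitrX ?Gq_unit.
Qed.

Lemma fqd_eq_dgcd i j : adj C i j -> (1 < fmul C i j)%N ->
  phi (CKP Q i j) = mulmat (Cqtmu Q C) (q_minus_D Q C) i j * t ->
  dgcd Q i j = fqd Q i.
Proof.
move=> aij f_gt1 /(phi_CKP_adj_eq aij) eqS.
pose ev : {rmorphism ZGamma C -> rat} := @gamma_eval2 I C.
have evS : ev (\sum_(1 <= k < (gmul C i j).+1) Gmu C i j k) != 0.
  rewrite rmorph_sum (eq_bigr (fun=> 1)) => [|k _]; last exact: gamma_eval2_mu.
  rewrite sumr_const_nat subn1 pnatr_eq0 /= (gmul_edges Q_type aij).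
  by rewrite cards_eq0 -(adj_edges Q_type).
exact: (pow2_qint_inj (dgcd_gt0 Q i j) (fqd_gt0 Q i) f_gt1
  (gamma_eval2_qint C _ _) (gamma_eval2_qint C _ _) (rmorph_mulIf evS eqS)).
Qed.

End MonomialImage.

Theorem proposition3p1 (I : finType) (C : I -> I -> int)
  (Q : fractional_quiver I) (g : arrow Q -> nat)
  (C_GCM : irreducible_symmetrizable_GCM C)
  (Q_type : quiver_of_type Q C)
  (g_labelling : is_labelling C g) :
  (forall i j : I,
     monomial_transformation C g (CKP Q i j)
     = mulmat (Cqtmu Q C) (q_minus_D Q C) i j * Gt C)
  <->
  (forall i j : I, adj C i j -> fmul C i j = 1%N \/ fmul C j i = 1%N).
Proof.
split=> [eqC i j aij|f1 i j].
  have aji : adj C j i by rewrite (adjC Q_type).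
  have [|f_neq1] := eqVneq (fmul C i j) 1%N; first by left.
  have f_gt0 : (0 < fmul C i j)%N.
    by rewrite (fmul_fqd Q_type aij) divn_gt0 ?dgcd_gt0 // dvdn_leq ?dvdn_gcdr ?fqd_gt0.
  have f_gt1 : (1 < fmul C i j)%N by rewrite ltn_neqAle eq_sym f_neq1.
  have dE := fqd_eq_dgcd Q_type g_labelling aij f_gt1 (eqC i j).
  by right; rewrite (fmul_fqd Q_type aji) dgcdC dE divnn fqd_gt0.
have [aij|naij] := boolP (adj C i j).
  apply/(phi_CKP_adj_eq Q_type g_labelling aij).
  case: (f1 i j aij) => [->|fji].
    rewrite (qint1 (qint_Gq_lreg (dgcd_gt0 Q i j))).
    by rewrite (qint1 (qint_Gq_lreg (fqd_gt0 Q i))).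
  have aji : adj C j i by rewrite (adjC Q_type).
  have <- : dgcd Q i j = fqd Q i; last by [].
  by rewrite [RHS](fqd_dgcd Q j) -(fmul_fqd Q_type aji) fji muln1 dgcdC.
rewrite mul_q_minus_D; have [<-|nij] := eqVneq i j.
  rewrite phi_CKP_diag /Cqtmu eqxx; symmetry.
  exact: diag_weight (Gq_unit C) (Gt_unit C).
have cij_ge0 : ~~ (C i j < 0) by exact: naij.
rewrite (CKP_nadj Q_type nij naij) /Cqtmu (negbTE nij) (negbTE cij_ge0).
rewrite (mul0r (Gq C ^- fqd Q j)) (mul0r (Gt C)).
exact: rmorph0.
Qed.
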